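(* Let $\mathbb{N}_0=\{0,1,2,\dots\}$ and $\mathbb{N}=\{1,2,\dots\}$. For $n\in\mathbb{N}_0$ set $h_n=1/n!$, and define $y_n$ by $y_0=0$ and $y_{n+1}=y_n+\frac14(h_n+h_{n+1})+\frac12$ for $n\in\mathbb{N}_0$. Define $\tilde a\colon\mathbb{R}\to(0,\infty)$ by $$\tilde a(x)=\begin{cases}h_n&\text{if }x\in[y_n-\frac14h_n,\;y_n+\frac14h_n)\quad(n\in\mathbb{N}_0),\\[2pt] 1&\text{if }x\in[y_n+\frac14h_n,\;y_n+\frac14h_n+\frac12)\quad(n\in\mathbb{N}_0),\\[2pt] 1&\text{if }x\in(-\infty,0].\end{cases}$$ For each $n\in\mathbb{N}_0$ let $\chi_n\in C_c^\infty(\mathbb{R})$ satisfy $\chi_n\ge0$, $\int\chi_n=1$, $\operatorname{supp}\chi_n\subseteq[-\frac18h_n,\frac18h_n]$ and $\chi_n(-x)=\chi_n(x)$ for all $x\in\mathbb{R}$. Define $a\in C^\infty(\mathbb{R})$ by $$a(x)^{-1}=\begin{cases}(\chi_0*\tilde a^{-1})(x)&\text{if }x\le0,\\[2pt](\chi_n*\tilde a^{-1})(x)&\text{if }n\in\mathbb{N}_0\text{ and }x\in[y_n-\frac14h_n-\frac14,\;y_n+\frac14h_n+\frac14).\end{cases}$$ Then $a$ is smooth, strictly positive and uniformly bounded, with $\inf a=0$, and the following hold. (i) For all $n\in\mathbb{N}$: $a(y)=h_n$ for all $y\in[y_n-\frac18h_n,\,y_n+\frac18h_n]$ and $\int_{y_n}^{y_{n+1}}a(x)^{-1}\,dx=1$.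 Hence $d(y_n;y_{n+1})=1$, while $a(y_n)=(n+1)\,a(y_{n+1})$, where $d(x;y)=\big|\int_x^y a(z)^{-1}dz\big|$. Consequently there are no $C\ge1$ and $\omega\ge0$ such that $a(y)\le C\,e^{\omega d(x;y)}a(x)$ for all $x,y\in\mathbb{R}$. (ii) The group $T$ on $L_\infty(\mathbb{R})$ associated with $X=a\,d/dx$ does not extend to a continuous group on $L_p(\mathbb{R};dx)$ for any $p\in[1,\infty)$. (iii) For all $p\in[1,\infty)$ and all $t>0$, the operator $S_t$ on $L_\infty(\mathbb{R})$ of the semigroup $S$ associated with $X$ does not extend to a continuous operator on $L_p(\mathbb{R};dx)$.
   Context: The measure on $\mathbb{R}$ is Lebesgue measure $dx$ (weight $\rho=1$). The coefficient $a$ satisfies $\int_0^\infty a(x)^{-1}dx=\infty=\int_{-\infty}^0a(x)^{-1}dx$. For $x_0\in\mathbb{R}$ let $t\mapsto e^{tX}x_0$ be the unique maximal solution of $\dot x=a(x)$, $x(0)=x_0$; it is defined for all $t\in\mathbb{R}$ and satisfies $\int_{x_0}^{e^{tX}x_0}a(x)^{-1}dx=t$. The group $T$ is $(T_t\varphi)(y)=\varphi(e^{-tX}y)$, $t\in\mathbb{R}$, and the semigroup $S$, generated by the weak$^*$ closure of $-X^2$, is $$S_t=(4\pi t)^{-1/2}\int_{-\infty}^\infty ds\,e^{-s^2(4t)^{-1}}\,T_s\qquad(t>0)$$ (weak$^*$ integral), both on $L_\infty(\mathbb{R})$. An operator on $L_\infty$ ''extends to a continuous operator on $L_p$'' if its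 restriction to $L_p\cap L_\infty$ extends to a bounded operator on $L_p(\mathbb{R};dx)$. $T$ ''extends to a continuous group on $L_p$'' if each $T_t$ extends in this sense and the extensions form a strongly continuous group on $L_p$. $*$ denotes convolution on $\mathbb{R}$. *)

(* Defs.v *)
From HB Require Import structures.
From mathcomp Require Import all_boot all_order all_algebra.
From mathcomp Require Import all_classical all_reals all_analysis.
From mathcomp Require Import ring lra.

Set Implicit Arguments.
Unset Strict Implicit.
Unset Printing Implicit Defensive.

Import Order.TTheory GRing.Theory Num.Theory.
Import numFieldNormedType.Exports.

Local Open Scope classical_set_scope.
Local Open Scope ring_scope.

Section functions_on_the_line.
Variable R : realType.
Implicit Types f g : R -> R.

Definition smooth f := forall (n : nat) (x : R), derivable (f^`(n))%classic x 1.

Definition supp f : set R := closure [set x | f x != 0].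

Definition convolution f g : R -> R :=
  fun x => \int[lebesgue_measure]_z (f (x - z) * g z).

(* The oriented integral of f from x to y. *)
Definition oriented_integral f (x y : R) : R :=
  if x <= y then \int[lebesgue_measure]_(z in `[x, y]) f z
  else - \int[lebesgue_measure]_(z in `[y, x]) f z.

End functions_on_the_line.

Section coefficient.
Variable R : realType.

Definition h (n : nat) : R := (n`!)%:R^-1.

Fixpoint y (n : nat) : R :=
  if n is m.+1 then y m + (h m + h m.+1) / 4 + 1 / 2 else 0.

Definition hump (n : nat) : interval R :=
  `[y n - h n / 4, y n + h n / 4[.

Definition gap (n : nat) : interval R :=
  `[y n + h n / 4, y n + h n / 4 + 1 / 2[.

(* The humps are pairwise disjoint, so [get n | x \in hump n] is the index of
   the hump containing x, if there is one, and 0 otherwise.  Outside the humps,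
   i.e. on the gaps and on the rest of the negative half-line, the value is 1;
   see atilde_hump, atilde_gap and atilde_le0. *)
Definition atilde (x : R) : R :=
  let n := [get n | x \in hump n] in if x \in hump n then h n else 1.

Definition cell (n : nat) : interval R :=
  `[y n - h n / 4 - 1 / 4, y n + h n / 4 + 1 / 4[.

(* The cells are pairwise disjoint and cover the positive half-line; see
   coeff_le0 and coeff_cell for the two defining equations. *)
Definition coeff (chi : nat -> R -> R) (x : R) : R :=
  let n := if x <= 0 then 0%N else [get n | x \in cell n] in
  (convolution (chi n) (fun z => (atilde z)^-1) x)^-1.

Definition dist (a : R -> R) (x z : R) : R :=
  `|oriented_integral (fun w => (a w)^-1) x z|.

End coefficient.

Arguments h {R}.
Arguments y {R}.
Arguments hump {R}.
Arguments gap {R}.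
Arguments cell {R}.

Section coefficient_equations.
Variable R : realType.
Implicit Types (n : nat) (x : R) (b : nat -> R).

Lemma h_gt0 n : 0 < h n :> R.
Proof. by rewrite /h invr_gt0 ltr0n fact_gt0. Qed.

Lemma h0 : h 0 = 1 :> R.
Proof. by rewrite /h fact0 invr1. Qed.

Lemma yS n : y n.+1 = y n + (h n + h n.+1) / 4 + 1 / 2 :> R.
Proof. by []. Qed.

Lemma step_unique b n m x : (forall k, b k <= b k.+1) ->
  b n <= x -> x < b n.+1 -> b m <= x -> x < b m.+1 -> n = m.
Proof.
move=> bS bn nb bm mb.
have mono : {homo b : i j / (i <= j)%N >-> i <= j}.
  by apply: homo_leq bS => // ? ? ?; exact: le_trans.
apply/eqP; rewrite eqn_leq (leqNgt n) (leqNgt m); apply/andP; split; apply/negP => lt.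
  by have := lt_le_trans mb (le_trans (mono _ _ lt) bn); rewrite ltxx.
by have := lt_le_trans nb (le_trans (mono _ _ lt) bm); rewrite ltxx.
Qed.

Lemma hump_step n : y n.+1 - h n.+1 / 4 = y n + h n / 4 + 1 / 2 :> R.
Proof. by rewrite yS; field. Qed.

Lemma cell_step n :
  y n.+1 - h n.+1 / 4 - 1 / 4 = y n + h n / 4 + 1 / 4 :> R.
Proof. by rewrite yS; field. Qed.

Let hump_start_le n : y n - h n / 4 <= y n.+1 - h n.+1 / 4 :> R.
Proof. by rewrite hump_step; have := h_gt0 n; lra. Qed.

Let cell_start_le n :
  y n - h n / 4 - 1 / 4 <= y n.+1 - h n.+1 / 4 - 1 / 4 :> R.
Proof. by rewrite cell_step; have := h_gt0 n; lra. Qed.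

Lemma hump_or_gap_unique n m x :
  y n - h n / 4 <= x < y n + h n / 4 + 1 / 2 ->
  y m - h m / 4 <= x < y m + h m / 4 + 1 / 2 -> n = m.
Proof.
move=> /andP[a1 a2] /andP[b1 b2].
apply: (@step_unique (fun k => y k - h k / 4) _ _ x) => //;
  by rewrite hump_step.
Qed.

Lemma cell_unique n m x : x \in cell n -> x \in cell m -> n = m.
Proof.
rewrite !in_itv/= => /andP[a1 a2] /andP[b1 b2].
apply: (@step_unique (fun k => y k - h k / 4 - 1 / 4) _ _ x) => //;
  by rewrite cell_step.
Qed.

Lemma atilde_hump n x : x \in hump n -> atilde x = h n.
Proof.
move=> xn; rewrite /atilde; set m := [get n | _].
have xm : x \in hump m.
  by rewrite /m; apply: (@getPex _ [set k | x \in hump k]); exists n.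
rewrite xm; congr h; move: xn xm; rewrite !in_itv/= => /andP[a1 a2] /andP[b1 b2].
by apply: (@hump_or_gap_unique _ _ x); apply/andP; split => //; lra.
Qed.

Lemma atilde_gap n x : x \in gap n -> atilde x = 1.
Proof.
rewrite in_itv/= => /andP[a1 a2]; rewrite /atilde; set m := [get n | _].
case: ifPn => // ; rewrite in_itv/= => /andP[b1 b2].
have nm : n = m.
  apply: (@hump_or_gap_unique _ _ x); apply/andP; split => //; try lra.
  by have := h_gt0 n; lra.
by move: a1 b2; rewrite nm; lra.
Qed.

Lemma atilde_le0 x : x <= 0 -> atilde x = 1.
Proof.
move=> x0; rewrite /atilde; set m := [get n | _].
case: ifPn => //; rewrite in_itv/= => /andP[b1 b2].
case: m b1 b2 => [|m] b1 b2; first by rewrite h0.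
have y0 : forall k, 0 <= y k - h k / 4 + 1 / 4 :> R.
  elim=> [|k IH]; first by rewrite h0 /=; lra.
  by rewrite hump_step; have := h_gt0 k; lra.
by move: b1; rewrite hump_step; have := y0 m; have := h_gt0 m; lra.
Qed.

Lemma coeff_le0 (chi : nat -> R -> R) x : x <= 0 ->
  (coeff chi x)^-1 = convolution (chi 0%N) (fun z => (atilde z)^-1) x.
Proof. by move=> x0; rewrite /coeff x0 invrK. Qed.

Lemma coeff_cell (chi : nat -> R -> R) n x : x \in cell n ->
  (coeff chi x)^-1 = convolution (chi n) (fun z => (atilde z)^-1) x.
Proof.
move=> xn; rewrite /coeff invrK; case: ifPn => x0.
  case: n xn => // n; rewrite in_itv/= => /andP[b1 _].
  have c0 : forall k, 0 < y k.+1 - h k.+1 / 4 - 1 / 4 :> R.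
    elim=> [|k]; first by rewrite cell_step /= h0; lra.
    by rewrite (cell_step k.+1); have := h_gt0 k.+1; lra.
  by have := c0 n; move: b1 x0; rewrite yS; lra.
set m := [get n | _].
have xm : x \in cell m.
  by rewrite /m; apply: (@getPex _ [set k | x \in cell k]); exists n.
by rewrite (cell_unique xn xm).
Qed.

End coefficient_equations.

Section operators.
Variable R : realType.

(* Operators on the spaces L_p are encoded as operators on functions that are
   only specified up to equality almost everywhere. *)
Definition operator := (R -> R) -> (R -> R).

Notation mu := (@lebesgue_measure R).

(* The first two clauses and the norm bound together force U to respect
   equality almost everywhere on L_p, so U is a bounded operator on classes. *)
Definition bounded_operator (p : \bar R) (U : operator) :=
  [/\ forall f, f \in Lfun mu p -> U f \in Lfun mu p,
      forall (c : R) f g, f \in Lfun mu p -> g \in Lfun mu p ->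
        \forall x \ae mu, U (fun z => c * f z + g z) x = c * U f x + U g x
    & exists M : R, forall f, f \in Lfun mu p ->
        ('N[mu]_p[EFin \o U f] <= M%:E * 'N[mu]_p[EFin \o f])%E].

Definition is_extension (p : \bar R) (V U : operator) :=
  bounded_operator p U /\
  forall f, f \in Lfun mu p -> f \in Lfun mu +oo%E ->
    \forall x \ae mu, U f x = V f x.

Definition extends_to_continuous_operator (p : \bar R) (V : operator) :=
  exists U : operator, is_extension p V U.

Definition strongly_continuous_group (p : \bar R) (U : R -> operator) :=
  [/\ forall t, bounded_operator p (U t),
      forall f, f \in Lfun mu p -> \forall x \ae mu, U 0 f x = f x,
      forall s t f, f \in Lfun mu p ->
        \forall x \ae mu, U (s + t) f x = U s (U t f) x
    & forall f t0, f \in Lfun mu p ->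
        Lnorm mu p (EFin \o (U t f \- U t0 f)) @[t --> t0] --> 0%E].

Definition extends_to_continuous_group (p : \bar R) (T : R -> operator) :=
  exists U : R -> operator,
    (forall t, is_extension p (T t) (U t)) /\ strongly_continuous_group p U.

(* A solution on all of R is maximal, and it is unique when a is smooth. *)
Definition is_integral_curve (a : R -> R) (x0 : R) (xi : R -> R) :=
  xi 0 = x0 /\ forall t : R, is_derive t 1 xi (a (xi t)).

(* flow a t x0 is e^{tX} x0 for X = a d/dx. *)
Definition flow (a : R -> R) (t x0 : R) : R :=
  [get xi | is_integral_curve a x0 xi] t.

Definition transport_group (a : R -> R) (t : R) : operator :=
  fun phi x => phi (flow a (- t) x).

(* psi is the weak* integral of w(s) F(s) ds in L_oo, the dual of L_1. *)
Definition is_weak_star_integral (w : R -> R) (F : R -> R -> R)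
    (psi : R -> R) :=
  psi \in Lfun mu +oo%E /\
  forall g, g \in Lfun mu 1%E ->
    \int[mu]_x (psi x * g x) =
    \int[mu]_s (w s * \int[mu]_x (F s x * g x)).

Definition gauss_weight (t s : R) : R :=
  (Num.sqrt (4 * pi * t))^-1 * expR (- (s ^+ 2 / (4 * t))).

(* The weak* integral is unique up to equality almost everywhere. *)
Definition heat_semigroup (a : R -> R) (t : R) : operator :=
  fun phi => [get psi | is_weak_star_integral (gauss_weight t)
                          (fun s => transport_group a s phi) psi].

End operators.

(* Main.v *)
(** Near the n-th hump, 1/a is the convolution of [chi n] with a step function,
    i.e. 1 + (1/h_n - 1) times the difference of two translates of a primitive
    of [chi n]; hence a is smooth.  A primitive F of 1/a straightens the flow:
    F (e^{tX} x) = F x + t.  As [chi n] is even, F (y_n) = n, and F is affine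
    with slope 1/h_n on the interval I_n = [y_n, y_n + h_n/8].  Therefore T_{-1}
    maps the indicator of I_{n+1} to the indicator of I_n, which is n + 1 times
    longer, and S_t maps it to a function that is bounded below on I_n by a
    positive number depending on t only.  Neither operator can be bounded on
    L_p. *)

Require Import Defs.
From HB Require Import structures.
From mathcomp Require Import all_boot all_order all_algebra.
From mathcomp Require Import all_classical all_reals all_analysis.
From mathcomp Require Import measurable_realfun ess_sup_inf.
From mathcomp Require Import ring lra.
Set Implicit Arguments.
Unset Strict Implicit.
Unset Printing Implicit Defensive.
Import Order.TTheory GRing.Theory Num.Theory.
Import numFieldNormedType.Exports.

Local Open Scope classical_set_scope.
Local Open Scope ring_scope.

(** * Primitives *)

(** The coefficient is shaped so that one operator acts on all humps at once. A hump has length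
    [h n / 2] and is crossed at speed [h n], so it costs time 1/2 whatever [n] is, and each gap
    costs another 1/2; evenness of the kernels keeps the total exact after smoothing. The ratio
    [h n / h n.+1 = n + 1] then forces, at one fixed time, an L_p operator norm of at least a
    constant times [(n + 1)^(1/p)], which is unbounded for every finite [p]. Two objects are
    obtained by choice: the flow, which enters only through its straightening identity, and [S_t],
    which has a meaning only once a weak* integral is known to exist. For indicators such an
    integral is written down explicitly and justified by Fubini, and uniqueness almost everywhere
    carries the lower bound over to the chosen function. *)

Section calculus.
Variable R : realType.
Implicit Types f g F : R -> R.
Notation mu := (@lebesgue_measure R).

Lemma continuous_itv_integrable f (u v : R) : continuous f ->
  mu.-integrable `[u, v] (EFin \o f).
Proof.
move=> cf; apply: continuous_compact_integrable; first exact: segment_compact.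
exact: continuous_subspaceT.
Qed.

(** No finite base point lies to the left of all [x], so the integral starts at [- N] with [N]
    growing with [|x|]. Subtracting the value at 0 makes the result independent of [N]; near [x] it
    therefore agrees with the function for the fixed [N = |x| + 2], to which the fundamental theorem
    applies. *)
Lemma continuous_antiderivative f : continuous f ->
  exists F, (forall x : R, is_derive x 1 F (f x)) /\ F 0 = 0.
Proof.
move=> cf; have intf u v := @continuous_itv_integrable f u v cf.
pose G N x := \int[mu]_(t in `[- N, x]) f t - \int[mu]_(t in `[- N, 0]) f t.
have GE N M x : 0 <= M -> M <= N -> - M <= x -> G N x = G M x.
  move=> M0 MN Mx.
  have E z : - M <= z -> \int[mu]_(t in `[- N, z]) f t =
      \int[mu]_(t in `[- N, - M]) f t + \int[mu]_(t in `[- M, z]) f t.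
    move=> Mz; apply/eqP; rewrite addrC -subr_eq; apply/eqP.
    rewrite Rintegral_itvB ?bnd_simp ?lerN2// Rintegral_itv_obnd_cbnd//.
    by apply: integrableS (intf (- M) z) => //; apply: subset_itvr;
      rewrite bnd_simp.
  by rewrite /G (E x)// (E 0) ?oppr_le0//; ring.
exists (fun x => G (`|x| + 1) x); split; last by rewrite /G subrr.
move=> x; have xltM : - (`|x| + 2) < x < `|x| + 2.
  by have := ler_norm x; have := ler_norm (- x); rewrite normrN => ? ?;
    apply/andP; split; lra.
case/andP: (xltM) => xlM xltM'.
have [dG GE'] := @continuous_FTC1 R f (BLeft _) x _ xltM' (intf _ _) xlM (cf x).
have DG : is_derive x 1 (G (`|x| + 2)) (f x).
  rewrite /G -[f x]subr0; apply: is_deriveB.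
  by rewrite -GE' derive1E; exact: derivableP.
apply: near_eq_is_derive DG.
near=> z; apply: GE; first by rewrite addr_ge0.
- rewrite [_ + 2](_ : _ = `|x| + 1 + 1); last by ring.
  rewrite lerD2r.
  have : `|z - x| < 1 by near: z; exact: (cvgr_distC_lt id).
  by have := ler_normD (z - x) x; rewrite subrK => ? ?; lra.
- by have := ler_norm (- z); rewrite normrN => ?; lra.
Unshelve. all: by end_near. Qed.

(** Only the derivative and the value at 0 of the chosen function are ever used, never the integral
    that produced it. *)
Definition primitive f : R -> R :=
  get [set F | (forall x : R, is_derive x 1 F (f x)) /\ F 0 = 0].

Lemma is_derive_primitive f (x : R) : continuous f ->
  is_derive x 1 (primitive f) (f x).
Proof. by move=> /continuous_antiderivative/getPex[]. Qed.

Lemma continuous_primitive f : continuous f -> continuous (primitive f).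
Proof.
move=> cf x; apply/differentiable_continuous/derivable1_diffP.
by have [] := is_derive_primitive x cf.
Qed.

Lemma is_derive_divr (c x : R) : is_derive x 1 (fun z => z / c) c^-1.
Proof.
rewrite (_ : (fun z => z / c) = c^-1 \*: id).
  by rewrite -[X in is_derive _ _ _ X]mulr1; exact: is_deriveZ.
by apply/funext => z /=; rewrite mulrC.
Qed.

Lemma primitive0 f : continuous f -> primitive f 0 = 0.
Proof. by move=> /continuous_antiderivative/getPex[]. Qed.

Lemma eq_derive_diff f F G (u v : R) : u <= v ->
  (forall x : R, u <= x <= v -> is_derive x 1 F (f x)) ->
  (forall x : R, u <= x <= v -> is_derive x 1 G (f x)) ->
  F v - F u = G v - G u.
Proof.
move=> uv dF dG.
have dH (x : R) : u <= x <= v -> is_derive x 1 (F \- G) 0.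
  by move=> xuv; rewrite -(subrr (f x)); apply: is_deriveB;
    [exact: dF|exact: dG].
have [x||c _] := @MVT_segment R (F \- G) (fun=> 0) _ _ uv.
- by rewrite in_itv/= => /andP[? ?]; apply: dH; rewrite !ltW.
- apply: derivable_within_continuous => x; rewrite in_itv/= => xuv.
  by have := dH x xuv => -[].
by rewrite mul0r /= => /eqP; rewrite subr_eq0 => /eqP; lra.
Qed.

Lemma integral_antiderivative f F (u v : R) : u <= v -> continuous f ->
  (forall x : R, is_derive x 1 F (f x)) ->
  (\int[mu]_(x in `[u, v]) (f x)%:E)%E = (F v - F u)%:E.
Proof.
rewrite le_eqVlt => /predU1P[->|uv] cf dF.
  by rewrite set_itv1 integral_set1 subrr.
have cF : continuous F.
  by move=> x; apply/differentiable_continuous/derivable1_diffP;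
    have [] := dF x.
rewrite (@continuous_FTC2 _ _ F)// ?EFinB//.
- exact: continuous_subspaceT.
- split.
  + by move=> x _; have [] := dF x.
  + exact/cvg_at_right_filter/cF.
  + exact/cvg_at_left_filter/cF.
- by move=> x _; rewrite derive1E; have [] := dF x.
Qed.

(** [F] has to be an antiderivative on [[u, v]] only, so a formula for [f] that is valid on a single
    cell still computes the increment. *)
Lemma primitive_diff f (u v : R) (F : R -> R) : continuous f -> u <= v ->
  (forall x : R, u <= x <= v -> is_derive x 1 F (f x)) ->
  primitive f v - primitive f u = F v - F u.
Proof.
by move=> cf uv dF; apply: (@eq_derive_diff f) => // x _;
  exact: is_derive_primitive.
Qed.

Lemma Rintegral_primitive f (u v : R) : continuous f -> u <= v ->
  \int[mu]_(x in `[u, v]) f x = primitive f v - primitive f u.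
Proof.
move=> cf uv; rewrite /Rintegral.
by rewrite (integral_antiderivative uv cf (fun x => is_derive_primitive x cf)).
Qed.

End calculus.

(** * Smooth functions *)

Section smoothness.
Variable R : realType.
Implicit Types f g : R -> R.

(** Peeling the derivatives off from the inside turns the product and quotient rules into inductions
    on the order; [smoothP] leads back to [smooth]. *)
Fixpoint derivable_upto (n : nat) f : Prop :=
  (forall x : R, derivable f x 1) /\
  if n is m.+1 then derivable_upto m f^`()%classic else True.

Lemma derivable_uptoW n f : derivable_upto n.+1 f -> derivable_upto n f.
Proof.
elim: n f => [|n IH] f [df duf]; first by split.
by split => //; exact: IH.
Qed.

Lemma smoothP f : smooth f <-> forall n, derivable_upto n f.
Proof.
split => [|uf n].
  move=> sf n; elim: n f sf => [|n IH] f sf; split => //; try exact: (sf 0%N).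
  by apply: IH => m x; rewrite -derive1Sn; exact: sf.
elim: n f uf => [|n IH] f uf x; first by have [] := uf 0%N.
by rewrite derive1Sn; apply: IH => m; have [] := uf m.+1.
Qed.

Lemma derivable_upto_cst n (c : R) : derivable_upto n (cst c).
Proof.
elim: n c => [|n IH] c; split => //; try by move=> x; exact: derivable_cst.
rewrite (_ : (_)^`()%classic = cst 0); first exact: IH.
by apply/funext => z; rewrite derive1_cst.
Qed.

Lemma derivable_uptoD n f g : derivable_upto n f -> derivable_upto n g ->
  derivable_upto n (f \+ g).
Proof.
elim: n f g => [|n IH] f g [df uf] [dg ug]; split => //;
  try by move=> x; exact: derivableD.
rewrite (_ : _^`()%classic = f^`()%classic \+ g^`()%classic); first exact: IH.
by apply/funext => z; rewrite /= !derive1E deriveD.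
Qed.

Lemma derivable_uptoM n f g : derivable_upto n f -> derivable_upto n g ->
  derivable_upto n (f \* g).
Proof.
elim: n f g => [|n IH] f g uf ug; have [df uf'] := uf; have [dg ug'] := ug;
  split => //; try by move=> x; exact: derivableM.
rewrite (_ : _^`()%classic = (f \* g^`()%classic) \+ (g \* f^`()%classic)).
  by apply: derivable_uptoD; apply: IH => //; exact: derivable_uptoW.
by apply/funext => z; rewrite /= !derive1E deriveM.
Qed.

(** The derivative [- f' (1/f)^2] contains [1/f] itself, but only up to the order already
    treated. *)
Lemma derivable_uptoV n f : (forall x, f x != 0) -> derivable_upto n f ->
  derivable_upto n (fun x => (f x)^-1).
Proof.
move=> f0; elim: n => [|n IH] uf; have [df uf'] := uf;
  split => //; try by move=> x; exact: derivableV.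
have {}IH := IH (derivable_uptoW uf).
rewrite (_ : _^`()%classic =
    cst (-1) \* (f^`()%classic \*
                 ((fun x => (f x)^-1) \* (fun x => (f x)^-1)))).
  apply: derivable_uptoM; first exact: derivable_upto_cst.
  by apply: derivable_uptoM => //; apply: derivable_uptoM.
apply/funext => z; rewrite /= !derive1E deriveV// /GRing.scale/=.
by rewrite -exprVn expr2; ring.
Qed.

Lemma smooth_cst (c : R) : smooth (cst c).
Proof. by apply/smoothP => n; exact: derivable_upto_cst. Qed.

Lemma smoothD f g : smooth f -> smooth g -> smooth (f \+ g).
Proof.
by move=> /smoothP sf /smoothP sg; apply/smoothP => n; exact: derivable_uptoD.
Qed.

Lemma smoothM f g : smooth f -> smooth g -> smooth (f \* g).
Proof.
by move=> /smoothP sf /smoothP sg; apply/smoothP => n; exact: derivable_uptoM.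
Qed.

Lemma smoothV f : (forall x, f x != 0) -> smooth f ->
  smooth (fun x => (f x)^-1).
Proof.
by move=> f0 /smoothP sf; apply/smoothP => n; exact: derivable_uptoV.
Qed.

Lemma smooth_continuous f : smooth f -> continuous f.
Proof.
by move=> sf x; apply/differentiable_continuous/derivable1_diffP;
  exact: (sf 0%N).
Qed.

Lemma smooth_antiderivative f (F : R -> R) :
  (forall x : R, is_derive x 1 F (f x)) -> smooth f -> smooth F.
Proof.
move=> dF sf; have Ff : F^`()%classic = f.
  by apply/funext => x; rewrite derive1E; have [] := dF x.
case=> [|n] x; first by have [] := dF x.
by rewrite derive1Sn Ff; exact: sf.
Qed.

Lemma is_derive_translate f (c x df : R) : is_derive (x - c) 1 f df ->
  is_derive x 1 (fun z => f (z - c)) df.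
Proof.
move=> dfx; rewrite -[df]mulr1.
have dshift := is_derive_shift x 1 (- c).
exact: (@is_derive1_comp R f (shift (- c)) x df 1 dfx dshift).
Qed.

Lemma smooth_translate f (c : R) : smooth f -> smooth (fun x => f (x - c)).
Proof.
move=> sf; suff E n : (fun x => f (x - c))^`(n)%classic =
    fun x => (f^`(n))%classic (x - c).
  move=> n x; rewrite E.
  by have [] := is_derive_translate (derivableP (sf n (x - c))).
elim: n => [|n IH] //; apply/funext => x.
rewrite !derive1nS IH !derive1E.
by have [_ ->] := is_derive_translate (derivableP (sf n (x - c))).
Qed.

Lemma smooth_local f :
  (forall x : R, exists2 g, smooth g & \forall z \near x, f z = g z) ->
  smooth f.
Proof.
move=> locf n x; have [g sg fg] := locf x.
have E m : \forall z \near x, (f^`(m))%classic z = (g^`(m))%classic z.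
  (* Equality near [x] is also equality near every point close to [x], so it passes to the
     derivatives on a neighbourhood. *)
  elim: m => [|m /near_join IH] //; near=> z.
  rewrite !derive1nS !derive1E; apply: near_eq_derive.
  by near: z.
apply: near_eq_derivable (sg n x).
by have := E n; apply: filterS => z ->.
Unshelve. all: by end_near. Qed.

End smoothness.

(** * Primitives of an even bump function *)

Section bump.
Variables (R : realType) (r : R) (chi : R -> R).
Hypothesis r_ge0 : 0 <= r.
Hypothesis chi_cont : continuous chi.
Hypothesis chi_ge0 : forall x, 0 <= chi x.
Hypothesis chi_int : \int[lebesgue_measure]_x chi x = 1.
Hypothesis chi_supp : supp chi `<=` `[- r, r].
Hypothesis chi_even : forall x, chi (- x) = chi x.
Notation mu := (@lebesgue_measure R).
Local Notation Phi := (primitive chi).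

Let dPhi (x : R) : is_derive x 1 Phi (chi x).
Proof. exact: is_derive_primitive. Qed.

Lemma bump_eq0 x : ~~ (- r <= x <= r) -> chi x = 0.
Proof.
apply: contraNeq => x0; suff : `[- r, r]%classic x by rewrite /= in_itv.
exact/chi_supp/subset_closure.
Qed.

Lemma primitive_bump_nd (u v : R) : u <= v -> Phi u <= Phi v.
Proof.
by move=> uv; rewrite -subr_ge0 -Rintegral_primitive//; exact: Rintegral_ge0.
Qed.

Lemma is_derive_reflect (f : R -> R) (c x df : R) : is_derive (c - x) 1 f df ->
  is_derive x 1 (fun z => f (c - z)) (- df).
Proof.
move=> dfx; have dc : is_derive x 1 (fun z : R => c - z) (-1).
  rewrite -[X in is_derive _ _ _ X]add0r; apply: is_deriveB.
rewrite -mulrN1.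
exact: (@is_derive1_comp R f (fun z => c - z) x df (-1) dfx dc).
Qed.

Lemma is_derive_reflectN (f : R -> R) (c x df : R) : is_derive (c - x) 1 f df ->
  is_derive x 1 (fun z => - f (c - z)) df.
Proof. by move=> /is_derive_reflect/is_deriveN; rewrite opprK. Qed.

(** As [chi] is even, [- Phi (- u)] is another antiderivative of [chi] that vanishes at 0. *)
Lemma primitive_bump_odd u : Phi (- u) = - Phi u.
Proof.
wlog u0 : u / 0 <= u => [H|].
  have [|/ltW u0] := leP 0 u; first exact: H.
  by rewrite -[in RHS](opprK u) (H (- u)) ?opprK// oppr_ge0.
have dR (x : R) : is_derive x 1 (fun z => - Phi (0 - z)) (chi x).
  by apply: is_derive_reflectN; rewrite sub0r -chi_even.
have := primitive_diff chi_cont u0 (fun x _ => dR x).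
by rewrite !sub0r oppr0 primitive0// => ?; lra.
Qed.

(** The mass 1 lies in [[- r, r]], oddness of [Phi] splits it into equal halves, and [Phi] is
    constant beyond [r]. *)
Lemma primitive_bump_half u : r <= u -> Phi u = 1 / 2.
Proof.
move=> ru.
have -> : Phi u = Phi r.
  have [x||c _] := @MVT_segment R Phi (fun=> 0) _ _ ru.
  - rewrite in_itv/= => /andP[rx xu].
    by rewrite -(@bump_eq0 x) ?negb_and -?ltNge ?rx ?orbT//; exact: dPhi.
  - apply: derivable_within_continuous => x _; by have [] := dPhi x.
  by rewrite mul0r => /eqP; rewrite subr_eq0 => /eqP.
have : \int[mu]_(x in `[- r, r]) chi x = 1.
  rewrite -chi_int Rintegral_mkcond; apply: eq_Rintegral => x _.
  by rewrite patchE mem_setE in_itv/=; case: ifPn => // /bump_eq0.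
have rr : - r <= r by rewrite (le_trans _ r_ge0)// oppr_le0.
by rewrite Rintegral_primitive// primitive_bump_odd => ?; lra.
Qed.

Lemma primitive_bump_halfN u : u <= - r -> Phi u = - (1 / 2).
Proof.
move=> ur; rewrite -[u]opprK primitive_bump_odd primitive_bump_half//.
by rewrite lerNr.
Qed.

Let Phi_cont : continuous Phi.
Proof. exact: continuous_primitive. Qed.

Lemma primitive2_bump_even u : primitive Phi (- u) = primitive Phi u.
Proof.
wlog u0 : u / 0 <= u => [H|].
  have [|/ltW u0] := leP 0 u; first exact: H.
  by rewrite -[in RHS](opprK u) (H (- u)) ?opprK// oppr_ge0.
have dR (x : R) : is_derive x 1 (fun z => primitive Phi (0 - z)) (Phi x).
  have := @is_derive_reflect (primitive Phi) 0 x _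
    (is_derive_primitive _ Phi_cont).
  by rewrite sub0r primitive_bump_odd opprK.
have := primitive_diff Phi_cont u0 (fun x _ => dR x).
by rewrite !sub0r oppr0 => /addIr.
Qed.

Lemma primitive2_bump_diff u v : r <= u -> u <= v ->
  primitive Phi v - primitive Phi u = (v - u) / 2.
Proof.
move=> ru uv; rewrite mulrBl;
  apply: (primitive_diff (F := fun z => z / 2) Phi_cont uv).
move=> x /andP[ux _]; rewrite primitive_bump_half ?(le_trans ru)//.
by rewrite div1r; exact: is_derive_divr.
Qed.

Let integrable_bump_reflect (x : R) :
  mu.-integrable setT (EFin \o (fun z => chi (x - z))).
Proof.
have -> : (fun z => chi (x - z)) = (fun z => chi (x - z)) \_ `[x - r, x + r].
  apply/funext => z; rewrite patchE mem_setE in_itv/=; case: ifPn => // xz.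
  by rewrite bump_eq0//; apply: contra xz => /andP[? ?]; apply/andP; split; lra.
rewrite -restrict_EFin; apply/(integrable_mkcond _ _).1 => //.
apply: continuous_itv_integrable => z; apply: continuous_comp;
  last exact: chi_cont.
by apply: cvgB; [exact: cvg_cst|exact: cvg_id].
Qed.

Let Rintegral_bump_reflect (x u v : R) : u <= v ->
  \int[mu]_(z in `[u, v]) chi (x - z) = Phi (x - u) - Phi (x - v).
Proof.
move=> uv; have cf : continuous (fun z => chi (x - z)).
  move=> z; apply: continuous_comp; last exact: chi_cont.
  by apply: cvgB; [exact: cvg_cst|exact: cvg_id].
have dF (z : R) : is_derive z 1 (fun z => - Phi (x - z)) (chi (x - z)).
  exact: is_derive_reflectN.
by rewrite /Rintegral (integral_antiderivative uv cf dF)/= opprK addrC.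
Qed.

(** The kernel sees only [[x - r, x + r]], so [g] needs to be a step there and nowhere else. The
    constant 1 is reproduced by the total mass, and the indicator yields an increment of [Phi]. *)
Lemma convolution_bump_step (g : R -> R) (c u v x : R) : u <= v ->
  (forall z, x - r <= z <= x + r -> g z = 1 + c * \1_(`[u, v[) z) ->
  convolution chi g x = 1 + c * (Phi (x - u) - Phi (x - v)).
Proof.
(* Outside its set a restriction takes the default value [point], which is 0 in [R]. *)
move=> uv gE; rewrite /convolution; have pt0 : @point R = 0 by [].
have -> : \int[mu]_z (chi (x - z) * g z) =
    \int[mu]_z (chi (x - z) + c * ((fun z => chi (x - z)) \_ `[u, v[) z).
  apply: eq_Rintegral => z _; rewrite patchE.
  have [xz|xz] := boolP (x - r <= z <= x + r).
    by rewrite gE// indicE; case: (_ \in _); rewrite ?pt0 /=; ring.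
  rewrite bump_eq0; first by rewrite pt0 if_same; ring.
  by apply: contra xz => /andP[? ?]; apply/andP; split; lra.
have int1 : mu.-integrable setT (EFin \o ((fun z => chi (x - z)) \_ `[u, v[)).
  rewrite -restrict_EFin; apply/(integrable_mkcond _ _).1 => //.
  exact: integrableS (integrable_bump_reflect x).
rewrite RintegralD//; last first.
  rewrite (_ : _ \o _ =
    (fun z => c%:E * (EFin \o ((fun z => chi (x - z)) \_ `[u, v[)) z)%E)//.
  exact: integrableZl.
rewrite RintegralZl// -Rintegral_mkcond Rintegral_itv_bndo_bndc; last first.
  exact: integrableS (integrable_bump_reflect x).
rewrite Rintegral_bump_reflect//; congr (_ + _).
have -> : \int[mu]_z chi (x - z) = \int[mu]_(z in `[x - r, x + r]) chi (x - z).
  rewrite [RHS]Rintegral_mkcond; apply: eq_Rintegral => z _.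
  rewrite patchE mem_setE in_itv/=; case: ifPn => // xz.
  by rewrite bump_eq0//; apply: contra xz => /andP[? ?]; apply/andP; split; lra.
rewrite Rintegral_bump_reflect; last by have := r_ge0; lra.
rewrite primitive_bump_half ?primitive_bump_halfN; lra.
Qed.

End bump.

(** * The coefficient *)

Section coefficient_shape.
Variable R : realType.

Lemma h_le1 n : h n <= 1 :> R.
Proof. by rewrite /h invf_le1 ?ltr0n ?fact_gt0// ler1n fact_gt0. Qed.

Lemma hS n : h n = n.+1%:R * h n.+1 :> R.
Proof.
rewrite /h factS natrM invfM mulrA divff ?mul1r//.
Qed.

Lemma y_ge n : n%:R / 2 <= y n :> R.
Proof.
elim: n => [|n IH]; first by rewrite mul0r.
by rewrite yS -natr1; have := h_gt0 R n; have := h_gt0 R n.+1; lra.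
Qed.

(** The right ends of the cells exceed [n / 2]. The least [n] whose right end lies beyond [x] works,
    because each cell starts where its predecessor stops. *)
Lemma cell_cover (x : R) : 0 < x -> exists n, x \in cell n.
Proof.
move=> x0; have exn : exists n, x < y n + h n / 4 + 1 / 4.
  have := archi_boundP (ltW (mulr_gt0 (ltr0n R 2) x0));
    set n := Num.bound _ => xn.
  by exists n; have := y_ge n; have := h_gt0 R n; lra.
case: (ex_minnP exn) => -[|n] xn nmin; [exists 0%N|exists n.+1].
  by rewrite in_itv/= xn andbT; rewrite /= h0; lra.
rewrite in_itv/= xn andbT cell_step leNgt; apply/negP => /nmin.
by rewrite ltnn.
Qed.

(** The range is the hump with the full gaps on both sides, wide enough to contain the kernel window
    of every point of the cell. *)
Lemma atilde_near_hump n (z : R) :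
  y n - h n / 4 - 1 / 2 <= z < y n + h n / 4 + 1 / 2 ->
  (atilde z)^-1 = 1 + ((h n)^-1 - 1) * \1_[set` hump n] z.
Proof.
move=> /andP[nz zn]; rewrite indicE.
have [zh|] := boolP (z \in hump n).
  by rewrite (atilde_hump zh) mem_set//=; ring.
move=> zh; rewrite memNset; last exact/negP.
rewrite mulr0 addr0; suff -> : atilde z = 1 by rewrite invr1.
move: zh; rewrite in_itv/= negb_and -ltNge -leNgt => /orP[zh|zh]; last first.
  by apply: (@atilde_gap _ n); rewrite in_itv/= zh.
(* To the left of hump 0 lies the negative half-line instead of a gap. *)
case: n nz zn zh => [|n] nz zn zh.
  by apply: atilde_le0; move: zh; rewrite /= h0; lra.
apply: (@atilde_gap _ n); rewrite in_itv/=.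
by move: nz zh; rewrite hump_step => ? ?; apply/andP; split; lra.
Qed.

End coefficient_shape.

(** * Local formulas for [1/a] and their gluing *)

Section coefficient_regularity.
Variables (R : realType) (chi : nat -> R -> R).
Hypothesis chi_smooth : forall n, smooth (chi n).
Hypothesis chi_ge0 : forall n x, 0 <= chi n x.
Hypothesis chi_int : forall n, \int[lebesgue_measure]_x chi n x = 1.
Hypothesis chi_supp : forall n, supp (chi n) `<=` `[- (h n / 8), h n / 8].
Hypothesis chi_even : forall n x, chi n (- x) = chi n x.
Local Notation Phi n := (primitive (chi n)).
Local Notation a := (coeff chi).

Let chi_cont n : continuous (chi n).
Proof. exact: smooth_continuous. Qed.

Let h8_ge0 n : 0 <= h n / 8 :> R.
Proof. by have := h_gt0 R n; lra. Qed.

Let half n u : h n / 8 <= u -> Phi n u = 1 / 2.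
Proof. exact: (primitive_bump_half (h8_ge0 n)). Qed.

Let halfN n u : u <= - (h n / 8) -> Phi n u = - (1 / 2).
Proof. exact: (primitive_bump_halfN (h8_ge0 n)). Qed.

(** The convolution of [chi n] with a step that has the n-th hump only, taken on the whole line;
    free of case distinctions, it is smooth by closure rules. *)
Definition icoeff n (x : R) : R :=
  1 + ((h n)^-1 - 1) *
      (Phi n (x - (y n - h n / 4)) - Phi n (x - (y n + h n / 4))).

Lemma icoeff_smooth n : smooth (icoeff n).
Proof.
have sPhi : smooth (Phi n).
  by apply: (@smooth_antiderivative _ (chi n)) => // x;
    exact: is_derive_primitive.
have -> : icoeff n = cst 1 \+ cst ((h n)^-1 - 1) \*
    ((fun x => Phi n (x - (y n - h n / 4))) \+
     cst (- 1) \* (fun x => Phi n (x - (y n + h n / 4)))).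
  by apply/funext => x; rewrite /icoeff /= mulN1r.
apply: smoothD; first exact: smooth_cst.
apply: smoothM; first exact: smooth_cst.
apply: smoothD; first exact: smooth_translate.
by apply: smoothM; [exact: smooth_cst|exact: smooth_translate].
Qed.

Lemma icoeff_ge1 n x : 1 <= icoeff n x.
Proof.
rewrite /icoeff lerDl mulr_ge0//.
  by rewrite subr_ge0 invf_ge1 ?h_gt0// h_le1.
rewrite subr_ge0; apply: primitive_bump_nd => //.
by have := h_gt0 R n; lra.
Qed.

Lemma icoeff_outside n x :
  x <= y n - h n / 4 - h n / 8 \/ y n + h n / 4 + h n / 8 <= x ->
  icoeff n x = 1.
Proof.
have := h_gt0 R n; rewrite /icoeff => h_gt0 [xn|xn].
  by rewrite !halfN; [ring|lra|lra].
by rewrite !half; [ring|lra|lra].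
Qed.

(** Here the two translates of [Phi n] have reached the opposite plateaus [1/2] and [- 1/2], so
    their difference is 1. *)
Lemma icoeff_core n x : y n - h n / 8 <= x <= y n + h n / 8 ->
  icoeff n x = (h n)^-1.
Proof.
move=> /andP[nx xn]; have := h_gt0 R n; rewrite /icoeff => h_gt0.
by rewrite half ?halfN; [field; rewrite gt_eqF|lra|lra].
Qed.

Lemma convolution_cell n x :
  y n - h n / 4 - 1 / 4 <= x <= y n + h n / 4 + 1 / 4 ->
  convolution (chi n) (fun z => (atilde z)^-1) x = icoeff n x.
Proof.
move=> /andP[nx xn]; have h_gt0 := h_gt0 R n; have h_le1 := h_le1 R n.
apply: (@convolution_bump_step _ (h n / 8)) => //; first by lra.
move=> z /andP[xz zx]; apply: atilde_near_hump; apply/andP; split; lra.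
Qed.

Lemma coeff_inv_le0 x : x <= 0 -> (a x)^-1 = 1.
Proof.
move=> x0; rewrite coeff_le0//.
(* A degenerate step with [c = 0] and [u = v = 0]: the kernel may reach into hump 0, but [atilde]
   equals [h 0 = 1] there. *)
transitivity (1 + 0 * (Phi 0%N (x - 0) - Phi 0%N (x - 0)));
  last by rewrite mul0r addr0.
apply: (@convolution_bump_step _ (h 0 / 8)) => //.
move=> z; rewrite h0 mul0r addr0 => /andP[_ zx].
suff -> : atilde z = 1 by rewrite invr1.
have [|z0] := leP z 0; first exact: atilde_le0.
by rewrite -(h0 R); apply: atilde_hump; rewrite in_itv/= h0; apply/andP; split;
  lra.
Qed.

(** The formula of a cell persists 1/8 beyond both ends, where it and the neighbouring formula both
    equal 1. The bound 3/8 is the gap length 1/2 minus the largest kernel radius 1/8. This overlap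
    is what makes [a] smooth where the kernel changes. *)
Lemma coeff_inv n x :
  y n - h n / 4 - 3 / 8 < x < y n + h n / 4 + 3 / 8 -> (a x)^-1 = icoeff n x.
Proof.
move=> /andP[nx xn]; have hn := h_gt0 R n; have hn1 := h_le1 R n.
have [xlo|xlo] := ltP x (y n - h n / 4 - 1 / 4).
  rewrite (@icoeff_outside n); last by left; lra.
  case: n nx xn hn hn1 xlo => [|n]; first by rewrite /= h0 => *;
    apply: coeff_inv_le0; lra.
  rewrite hump_step => nx xn hn hn1 xlo; have hm := h_gt0 R n;
    have hm1 := h_le1 R n.
  rewrite (@coeff_cell _ _ n); last by rewrite in_itv/=; apply/andP; split; lra.
  rewrite convolution_cell; last by apply/andP; split; lra.
  by rewrite icoeff_outside//; right; lra.
have [xhi|xhi] := ltP x (y n + h n / 4 + 1 / 4).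
  rewrite (@coeff_cell _ _ n); last by rewrite in_itv/= xlo.
  by rewrite convolution_cell// xlo ltW.
have hm := h_gt0 R n.+1; have hm1 := h_le1 R n.+1; have step := @hump_step R n.
rewrite (@coeff_cell _ _ n.+1); last by rewrite in_itv/=; apply/andP; split;
  lra.
rewrite convolution_cell; last by apply/andP; split; lra.
by rewrite !icoeff_outside//; [right|left]; lra.
Qed.

Lemma coeff_inv_near (x : R) :
  exists n, \forall z \near x, (a z)^-1 = icoeff n z.
Proof.
have [x0|x0] := leP x 0.
  (* As [h 0 = 1], [icoeff chi 0] is identically 1 and also serves the negative half-line. *)
  exists 0%N; have x1 : x < 1 / 4 by lra.
  near=> z; have z1 : z < 1 / 4 by near: z; exact: lt_nbhsl.
  have [z0|z0] := leP z 0; last first.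
    by apply: coeff_inv; rewrite /= h0; apply/andP; split; lra.
  by rewrite coeff_inv_le0// /icoeff h0; field.
have [n] := cell_cover x0; rewrite in_itv/= => /andP[nx xn]; exists n.
near=> z; apply: coeff_inv; apply/andP; split.
  by near: z; apply: lt_nbhsr; lra.
by near: z; apply: lt_nbhsl; lra.
Unshelve. all: by end_near. Qed.

Lemma coeff_inv_ge1 x : 1 <= (a x)^-1.
Proof.
by have [n /nbhs_singleton ->] := coeff_inv_near x; exact: icoeff_ge1.
Qed.

Lemma coeff_gt0 x : 0 < a x.
Proof. by rewrite -invr_gt0; exact: lt_le_trans (coeff_inv_ge1 x). Qed.

Lemma coeff_le1 x : a x <= 1.
Proof. by rewrite -invf_ge1 ?coeff_gt0// coeff_inv_ge1. Qed.

Lemma coeff_inv_smooth : smooth (fun x => (a x)^-1).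
Proof.
by apply: smooth_local => x;
  have [n] := coeff_inv_near x; exists (icoeff n) => //; exact: icoeff_smooth.
Qed.

Lemma coeff_smooth : smooth a.
Proof.
rewrite (_ : a = fun x => ((a x)^-1)^-1); last by apply/funext => x;
  rewrite invrK.
by apply: smoothV coeff_inv_smooth => x; rewrite invr_eq0 gt_eqF// coeff_gt0.
Qed.

Lemma coeff_core n x : x \in `[y n - h n / 8, y n + h n / 8] -> a x = h n.
Proof.
rewrite in_itv/= => xn; apply: invr_inj; rewrite -(icoeff_core xn);
  apply: coeff_inv.
by case/andP: xn => ? ?; have := h_gt0 R n; have := h_le1 R n => ? ?;
  apply/andP; split; lra.
Qed.

Lemma coeff_y n : a (y n) = h n.
Proof.
by apply: coeff_core; rewrite in_itv/=; have := h_gt0 R n => ?; apply/andP;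
  split; lra.
Qed.

(** The values [a (y n) = 1/n!] tend to 0, since [n! >= n]. *)
Lemma inf_coeff : inf (range a) = 0.
Proof.
have lb0 : lbound (range a) 0 by move=> _ [x _ <-]; exact/ltW/coeff_gt0.
apply/eqP; rewrite eq_le; apply/andP; split; last by apply: lb_le_inf => //;
  exists (a 0), 0.
rewrite leNgt; apply/negP => inf_gt0.
have := archi_boundP (ltW (divr_gt0 ltr01 inf_gt0)); set n := Num.bound _ => xn.
have : inf (range a) <= h n by rewrite -coeff_y; apply: ge_inf;
  [exists 0|exists (y n)].
apply/negP; rewrite -ltNge.
rewrite /h invf_plt ?posrE ?ltr0n ?fact_gt0//.
by rewrite -div1r (lt_le_trans xn)// ler_nat fact_geq.
Qed.

End coefficient_regularity.

(** * The flow and the travel time *)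

Section flow.
Variables (R : realType) (a : R -> R).
Hypothesis inv_cont : continuous (fun x => (a x)^-1).
Hypothesis inv_ge1 : forall x, 1 <= (a x)^-1.
Local Notation F := (primitive (fun x => (a x)^-1)).

Let dF (x : R) : is_derive x 1 F (a x)^-1.
Proof. exact: (is_derive_primitive x inv_cont). Qed.

Let F_cont : continuous F.
Proof. exact: continuous_primitive. Qed.

(** As [1/a >= 1], the mean value theorem shows that [F] does not shrink distances. Injectivity and
    surjectivity of [F], hence completeness of the flow, rest on this. *)
Lemma primitive_inv_expand (x z : R) : x <= z -> z - x <= F z - F x.
Proof.
move=> xz; have [t||c _ ->] := @MVT_segment R F (fun x => (a x)^-1) _ _ xz.
- by move=> _; exact: dF.
- exact: continuous_subspaceT.
- by rewrite ler_peMl// subr_ge0.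
Qed.

Lemma primitive_inv_le (x z : R) : (F x <= F z) = (x <= z).
Proof.
have [xz|zx] := leP x z; first by have := primitive_inv_expand xz; lra.
by have := primitive_inv_expand (ltW zx); lra.
Qed.

Lemma primitive_inv_inj : injective F.
Proof.
move=> x z Fxz; apply/eqP; rewrite eq_le.
by rewrite -(primitive_inv_le x z) -(primitive_inv_le z x) Fxz lexx.
Qed.

Lemma primitive_inv_surj v : exists x, F x = v.
Proof.
have lo : - `|v| <= 0 by rewrite oppr_le0.
have lh : - `|v| <= `|v| by rewrite (le_trans lo).
have [||x _ <-] := @IVT R F _ _ v lh; last by exists x.
- exact: continuous_subspaceT.
- have := primitive_inv_expand lo; have := primitive_inv_expand (normr_ge0 v).
  rewrite primitive0//; have := ler_norm v; have := ler_norm (- v);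
    rewrite normrN.
  move=> v1 v2 e1 e2; rewrite ge_min le_max; apply/andP; split.
    by apply/orP; left; lra.
  by apply/orP; right; lra.
Qed.

(** Along any integral curve [F] has derivative [(1/a) a = 1]; in particular this applies to the
    curve selected by [flow]. *)
Lemma integral_curve_primitive (x0 : R) (xi : R -> R) t :
  is_integral_curve a x0 xi -> F (xi t) = F x0 + t.
Proof.
move=> [<- dxi]; have dFxi (s : R) : is_derive s 1 (F \o xi) 1.
  rewrite -[X in is_derive _ _ _ X](@mulVf _ (a (xi s))).
    exact: is_derive1_comp.
  by rewrite -invr_eq0 gt_eqF// (lt_le_trans ltr01).
have [t0|/ltW t0] := leP 0 t.
  have := eq_derive_diff t0 (fun x _ => dFxi x) (fun x _ => is_derive_id x 1).
  by rewrite /=; lra.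
have := eq_derive_diff t0 (fun x _ => dFxi x) (fun x _ => is_derive_id x 1).
by rewrite /=; lra.
Qed.

(** The curve is [t |-> G (F x0 + t)] with [G] the inverse of [F], whose derivative is
    [1 / (1/a) = a]. *)
Lemma integral_curve_exists x0 : exists xi, is_integral_curve a x0 xi.
Proof.
have [G FG] := choice primitive_inv_surj.
have GF : cancel F G by move=> x; apply: primitive_inv_inj; rewrite FG.
(* The shift is written as a subtraction to fit [is_derive_translate]. *)
exists (fun t => G (t - (- F x0))); split; first by rewrite sub0r opprK GF.
move=> t; apply: is_derive_translate; rewrite opprK.
set x := G (t + F x0); have Fx : F x = t + F x0 by exact: FG.
have nGF : {near x, cancel F G} by near do exact: GF.
have nF : \near x, continuous_at x F by near do exact: F_cont.
have ax0 : (a x)^-1 != 0 by rewrite gt_eqF// (lt_le_trans ltr01).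
by have := is_derive_inverse nGF nF (dF x) ax0; rewrite Fx invrK.
Unshelve. all: by end_near. Qed.

Lemma primitive_flow t x : F (flow a t x) = F x + t.
Proof.
rewrite /flow; apply: integral_curve_primitive;
  exact: (getPex (integral_curve_exists x)).
Qed.

End flow.

(** * Travel times between the humps *)

Section travel_time.
Variables (R : realType) (chi : nat -> R -> R).
Hypothesis chi_smooth : forall n, smooth (chi n).
Hypothesis chi_ge0 : forall n x, 0 <= chi n x.
Hypothesis chi_int : forall n, \int[lebesgue_measure]_x chi n x = 1.
Hypothesis chi_supp : forall n, supp (chi n) `<=` `[- (h n / 8), h n / 8].
Hypothesis chi_even : forall n x, chi n (- x) = chi n x.
Local Notation Phi n := (primitive (chi n)).
Local Notation a := (coeff chi).
Local Notation F := (primitive (fun x => (a x)^-1)).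

Let h8_ge0 n : 0 <= h n / 8 :> R.
Proof. by have := h_gt0 R n; lra. Qed.

Let chi_cont n : continuous (chi n).
Proof. exact: smooth_continuous. Qed.

Let Phi_cont n : continuous (Phi n).
Proof. exact: continuous_primitive. Qed.

Let inv_cont : continuous (fun x => (a x)^-1).
Proof. exact/smooth_continuous/coeff_inv_smooth. Qed.

Let primitive2_diff n u v : h n / 8 <= u -> u <= v ->
  primitive (Phi n) v - primitive (Phi n) u = (v - u) / 2.
Proof. exact: (primitive2_bump_diff (h8_ge0 n)). Qed.

Let icoeff_primitive n (x : R) : R := x + ((h n)^-1 - 1) *
  (primitive (Phi n) (x - (y n - h n / 4)) -
   primitive (Phi n) (x - (y n + h n / 4))).

Let is_derive_icoeff_primitive n (x : R) :
  is_derive x 1 (icoeff_primitive n) (icoeff chi n x).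
Proof.
rewrite /icoeff_primitive /icoeff; apply: is_deriveD.
apply: (@is_deriveZ _ _ _ (fun x => primitive (Phi n) (x - (y n - h n / 4)) -
                                    primitive (Phi n) (x - (y n + h n / 4)))).
by apply: is_deriveB; apply: is_derive_translate; exact: is_derive_primitive.
Qed.

Let primitive_inv_cell n (u v : R) : u <= v ->
  y n - h n / 4 - 1 / 4 <= u -> v <= y n + h n / 4 + 1 / 4 ->
  F v - F u = icoeff_primitive n v - icoeff_primitive n u.
Proof.
move=> uv nu vn; apply: primitive_diff => // x /andP[ux xv].
rewrite (coeff_inv chi_smooth chi_int chi_supp chi_even (n := n)) //.
by apply/andP; split; lra.
Qed.

(* Evenness of [chi n] makes the two halves of a cell take equally long. *)
Lemma primitive_inv_right n : F (y n + h n / 4 + 1 / 4) - F (y n) = 1 / 2.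
Proof.
have hn := h_gt0 R n; have hn1 := h_le1 R n.
rewrite (@primitive_inv_cell n)//; try lra.
have E := primitive2_bump_even (@chi_cont n) (chi_even n) (h n / 4).
have D := @primitive2_diff n (1 / 4) (h n / 2 + 1 / 4).
rewrite /icoeff_primitive.
rewrite (_ : _ - (y n - h n / 4) = h n / 2 + 1 / 4); last by field.
rewrite (_ : _ - (y n + h n / 4) = 1 / 4); last by field.
rewrite (_ : y n - (y n - h n / 4) = h n / 4); last by field.
rewrite (_ : y n - (y n + h n / 4) = - (h n / 4)); last by field.
rewrite D; [|lra|lra]; rewrite E subrr.
by field; rewrite gt_eqF.
Qed.

(** Before smoothing, the half hump of length [h n / 4] is crossed at speed [h n] in time 1/4, and
    the half gap at speed 1 in time 1/4. *)
Lemma primitive_inv_left n : F (y n) - F (y n - h n / 4 - 1 / 4) = 1 / 2.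
Proof.
have hn := h_gt0 R n; have hn1 := h_le1 R n.
rewrite (@primitive_inv_cell n)//; try lra.
have E := primitive2_bump_even (@chi_cont n) (chi_even n).
have D := @primitive2_diff n (1 / 4) (h n / 2 + 1 / 4).
rewrite /icoeff_primitive.
rewrite (_ : y n - h n / 4 - 1 / 4 - (y n - h n / 4) = - (1 / 4));
  last by field.
rewrite (_ : y n - h n / 4 - 1 / 4 - (y n + h n / 4) = - (h n / 2 + 1 / 4));
  last by field.
rewrite (_ : y n - (y n - h n / 4) = h n / 4); last by field.
rewrite (_ : y n - (y n + h n / 4) = - (h n / 4)); last by field.
rewrite !E.
have := D; set P := primitive _ (1 / 4);
  set Q := primitive _ (h n / 2 + 1 / 4) => QP.
rewrite subrr mulr0 addr0.
have -> : P - Q = - ((h n / 2 + 1 / 4 - 1 / 4) / 2) by rewrite -QP;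
  [ring|lra|lra].
by field; rewrite gt_eqF.
Qed.

Lemma primitive_inv_y n : F (y n) = n%:R.
Proof.
elim: n => [|n IH]; first exact: primitive0.
have := primitive_inv_left n.+1; rewrite cell_step;
  have := primitive_inv_right n.
by rewrite IH -natr1; lra.
Qed.

Lemma primitive_inv_core n x : y n <= x <= y n + h n / 8 ->
  F x = n%:R + (x - y n) / h n.
Proof.
move=> /andP[nx xn]; rewrite -primitive_inv_y mulrBl.
suff -> : x / h n - y n / h n = F x - F (y n) by lra.
apply/esym;
  apply: (primitive_diff (F := fun z => z / h n)) => // z /andP[nz zx].
rewrite (coeff_core chi_smooth chi_int chi_supp chi_even (n := n)); last first.
  by rewrite in_itv/=; have := h_gt0 R n => ?; apply/andP; split; lra.
exact: is_derive_divr.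
Qed.

Lemma y_leS n : y n <= y n.+1 :> R.
Proof. by rewrite yS; have := h_gt0 R n; have := h_gt0 R n.+1; lra. Qed.

Lemma integral_inv_y n :
  \int[lebesgue_measure]_(x in `[y n, y n.+1]) (a x)^-1 = 1.
Proof.
rewrite (Rintegral_primitive inv_cont (y_leS n)) !primitive_inv_y -natr1; lra.
Qed.

Lemma dist_y n : dist a (y n) (y n.+1) = 1.
Proof. by rewrite /dist /oriented_integral y_leS integral_inv_y normr1. Qed.

(** From [y n.+1] to [y n] the coefficient grows by the factor [n + 1], while the distance stays 1;
    so [n + 1] would be bounded by [C e^w]. *)
Lemma coeff_not_exp_bounded :
  ~ exists C w : R, [/\ 1 <= C, 0 <= w
      & forall x z, a z <= C * expR (w * dist a x z) * a x].
Proof.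
move=> [C [w [C1 w0 aCw]]].
have K0 : 0 <= C * expR w by rewrite mulr_ge0 ?expR_ge0// (le_trans ler01).
have := archi_boundP K0; set n := Num.bound _ => Kn.
have distC : dist a (y n.+1) (y n) = 1.
  rewrite -(dist_y n) /dist /oriented_integral y_leS leNgt.
  by rewrite (_ : y n < y n.+1) ?normrN// yS; have := h_gt0 R n;
    have := h_gt0 R n.+1; lra.
have := aCw (y n.+1) (y n); rewrite distC mulr1.
rewrite !(coeff_y chi_smooth chi_int chi_supp chi_even) hS.
rewrite ler_pM2r ?h_gt0// -natr1 => ?; lra.
Qed.

End travel_time.

(** * Weak* integrals *)

Section almost_everywhere.
Context d (T : measurableType d) (R : realType).
Variable mu : {measure set T -> \bar R}.

Lemma ae_impl (P Q : T -> Prop) : (forall x, P x -> Q x) ->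
  (\forall x \ae mu, P x) -> \forall x \ae mu, Q x.
Proof. by move=> PQ; apply: filterS. Qed.

Lemma ae_impl2 (P P' Q : T -> Prop) : (forall x, P x -> P' x -> Q x) ->
  (\forall x \ae mu, P x) -> (\forall x \ae mu, P' x) -> \forall x \ae mu, Q x.
Proof. by move=> PQ; apply: filterS2. Qed.

Lemma ae_all (P : T -> Prop) : (forall x, P x) -> \forall x \ae mu, P x.
Proof. by move=> HP; apply: filterS filterT. Qed.

End almost_everywhere.

(** * Essentially bounded functions and indicators *)

Section essentially_bounded.
Variable R : realType.
Notation mu := (@lebesgue_measure R).
Implicit Types f g : R -> R.

Lemma Lfun_measurable (p : \bar R) f :
  f \in Lfun mu p -> measurable_fun setT f.
Proof. by case/andP => /set_mem. Qed.

Lemma Lfun_ooP f : f \in Lfun mu +oo%E <->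
  measurable_fun setT f /\ exists M : R, \forall x \ae mu, `|f x| <= M.
Proof.
(* The definition of the norm of order [+oo] distinguishes whether the whole space is null. *)
have muT : (0 < mu setT)%E.
  by rewrite -set_itvNyy lebesgue_measure_itv /= addye ?lt0y.
split=> [/andP[/set_mem mf /set_mem] | [mf [M fM]]].
  rewrite /= /finite_norm unlock muT => fin; split => //.
  exact: (@ess_supr_bounded _ _ R mu (fun x => `|f x|) fin).
apply/andP; split; first exact/mem_set.
apply/mem_set; rewrite /= /finite_norm unlock muT.
apply: (@le_lt_trans _ _ M%:E); last exact: ltry.
by apply/ess_supP; apply: (ae_impl _ fM) => x; rewrite /= lee_fin.
Qed.

Lemma Lfun_oo_integrable f (A : set R) : f \in Lfun mu +oo%E ->
  measurable A -> (mu A < +oo)%E -> mu.-integrable A (EFin \o f).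
Proof.
move=> /Lfun_ooP[mf [M fM]] mA muA; apply/integrableP; split.
  by apply/measurable_EFinP; exact: measurable_funTS.
apply: (@le_lt_trans _ _ (\int[mu]_(x in A) (cst `|M|%:E x))%E).
  apply: ae_ge0_le_integral => //.
  - apply: measurableT_comp => //; apply/measurable_EFinP;
      exact: measurable_funTS.
  - by move=> x _; rewrite lee_fin.
  - apply: (ae_impl _ fM) => x fxM _.
    by rewrite /= lee_fin (le_trans fxM)// ler_norm.
by rewrite integral_cst// lte_mul_pinfty// lee_fin.
Qed.

Lemma Lfun_oo_indic (A : set R) : measurable A -> \1_A \in Lfun mu +oo%E.
Proof.
move=> mA; apply/Lfun_ooP; split; first exact: measurable_indic.
exists 1; apply: ae_all => x; rewrite indicE.
by case: (x \in A); rewrite ?normr1 ?normr0.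
Qed.

Lemma Lnorm_indic (A : set R) (p : R) : p != 0 -> measurable A ->
  'N[mu]_p%:E[EFin \o \1_A]%E = (mu A `^ p^-1)%E.
Proof.
move=> p0 mA; rewrite unlock; congr (_ `^ _)%E.
rewrite -[in RHS](setIT A) -integral_indic//; apply: eq_integral => x _.
rewrite /= indicE; case: (x \in A).
  by rewrite normr1 powR1.
by rewrite normr0 powR0.
Qed.

Lemma Lfun_indic (A : set R) (p : R) : p != 0 -> measurable A ->
  (mu A < +oo)%E -> \1_A \in Lfun mu p%:E.
Proof.
move=> p0 mA muA; apply/andP; split; first exact/mem_set/measurable_indic.
apply/mem_set; rewrite /= /finite_norm Lnorm_indic//.
have muAf : mu A \is a fin_num by rewrite ge0_fin_numE.
by rewrite -(fineK muAf) poweR_EFin ltry.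
Qed.

End essentially_bounded.

(** * Uniqueness and existence of weak* integrals *)

Section weak_star_integral.
Variable R : realType.
Notation mu := (@lebesgue_measure R).

(** Indicators of measurable subsets of [A] are in L_1. Testing against them shows that [psi] and
    [psi'] have equal integrals over all these subsets. *)
Lemma weak_star_integral_unique (w : R -> R) (F : R -> R -> R)
    (psi psi' : R -> R) (A : set R) :
  is_weak_star_integral w F psi -> is_weak_star_integral w F psi' ->
  measurable A -> (mu A < +oo)%E -> \forall x \ae mu, A x -> psi x = psi' x.
Proof.
move=> [psioo Hpsi] [psioo' Hpsi'] mA muA.
suff : ae_eq mu A (EFin \o psi) (EFin \o psi').
  by apply: ae_impl => x H /H [].
apply: integral_ae_eq => //.
- exact: Lfun_oo_integrable.
- by apply/measurable_EFinP/measurable_funTS; exact: Lfun_measurable psioo'.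
move=> E EA mE; have muE : (mu E < +oo)%E.
  by rewrite (le_lt_trans _ muA)// le_measure ?inE.
have L f : f \in Lfun mu +oo%E ->
    (\int[mu]_(x in E) (EFin \o f) x)%E = (\int[mu]_x (f x * \1_E x))%:E.
  move=> foo; rewrite /Rintegral.
  have -> : (\int[mu]_x (f x * \1_E x)%:E = \int[mu]_(x in E) (EFin \o f) x)%E.
    rewrite [RHS]integral_mkcond; apply: eq_integral => x _.
    by rewrite patchE indicE; case: ifPn => _; rewrite ?mulr1 ?mulr0.
  by rewrite fineK//; apply: integrable_fin_num => //;
    exact: Lfun_oo_integrable.
have E1 : \1_E \in Lfun mu 1%E by apply: Lfun_indic; rewrite ?oner_eq0.
by rewrite !L// Hpsi// Hpsi'.
Qed.

Section existence.
Local Notation RR := (measurableTypeR R * measurableTypeR R)%type.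
Variables (w : R -> R) (A : set RR).
Hypothesis w_ge0 : forall s, 0 <= w s.
Hypothesis w_int : mu.-integrable setT (EFin \o w).
Hypothesis mA : measurable A.

Let psi (x : R) : R := \int[mu]_s (w s * \1_A (s, x)).

Let w_meas : measurable_fun setT w.
Proof. by apply/measurable_EFinP; exact: measurable_int w_int. Qed.

Let indic_sectionl s : measurable_fun setT (fun x : R => \1_A (s, x) : R).
Proof.
exact: (measurableT_comp (measurable_indic mA) (pair1_measurable s)).
Qed.

Let indic_sectionr x : measurable_fun setT (fun s : R => \1_A (s, x) : R).
Proof.
exact: (measurableT_comp (measurable_indic mA) (pair2_measurable x)).
Qed.

Let indic01 z : 0 <= (\1_A z : R) <= 1.
Proof. by rewrite indicE; case: (_ \in _); rewrite ?lexx ler01. Qed.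

Let w_indic_integrable x :
  mu.-integrable setT (fun s => (w s * \1_A (s, x))%:E).
Proof.
apply: le_integrable w_int => //.
  by apply/measurable_EFinP; exact: (measurable_funM w_meas (indic_sectionr x)).
move=> s _ /=; rewrite lee_fin normrM ger0_norm// ler_piMr//.
by case/andP: (indic01 (s, x)) => ? ?; rewrite ger0_norm.
Qed.

Let psi_EFin x : (psi x)%:E = (\int[mu]_s (w s * \1_A (s, x))%:E)%E.
Proof. by rewrite /psi /Rintegral fineK//; exact: integrable_fin_num. Qed.

(** The pointwise integral [psi] is bounded by the integral of [w]. The duality formula is Fubini
    for [w(s) 1_A(s, x) g(x)]. *)
Lemma weak_star_integral_exists :
  is_weak_star_integral w (fun s x => \1_A (s, x)) psi.
Proof.
have mwA : measurable_fun setT (fun z : RR => (w z.1 * \1_A z)%:E).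
  apply/measurable_EFinP; apply: measurable_funM; last exact: measurable_indic.
  exact: (measurableT_comp w_meas).
split.
  apply/Lfun_ooP; split.
    have wA0 z : (0 <= (w z.1 * \1_A z)%:E)%E.
      by rewrite lee_fin mulr_ge0//; case/andP: (indic01 z).
    apply/measurable_EFinP.
    rewrite (_ : _ \o _ = fubini_G mu (fun z => (w z.1 * \1_A z)%:E)).
      exact: (measurable_fun_fubini_tonelli_G (m1 := mu) _ mwA wA0).
    by apply/funext => x; rewrite /= psi_EFin.
  exists (\int[mu]_s w s); apply: ae_all => x.
  have psi0 : 0 <= psi x.
    by apply: Rintegral_ge0 => s _; rewrite mulr_ge0//;
      case/andP: (indic01 (s, x)).
  rewrite ger0_norm//; apply: le_Rintegral => //;
    first exact: w_indic_integrable.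
  move=> s _; by rewrite ler_piMr//; case/andP: (indic01 (s, x)).
move=> g /Lfun1_integrable g_int.
have mg : measurable_fun setT g by apply/measurable_EFinP;
  exact: measurable_int g_int.
pose f (z : RR) : \bar R := (w z.1 * (\1_A z * g z.2))%:E.
have mf : measurable_fun setT f.
  apply/measurable_EFinP; apply: measurable_funM;
    first exact: (measurableT_comp w_meas).
  by apply: measurable_funM;
    [exact: measurable_indic|exact: (measurableT_comp mg)].
have Ag_int s : mu.-integrable setT (fun x => (\1_A (s, x) * g x)%:E).
  apply: le_integrable g_int => //.
    by apply/measurable_EFinP; exact: (measurable_funM (indic_sectionl s) mg).
  move=> x _ /=; rewrite lee_fin normrM ler_piMl//.
  by case/andP: (indic01 (s, x)) => ? ?; rewrite ger0_norm.
have f_int : (mu \x mu)%E.-integrable setT f.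
  apply/(integrable12ltyP mu mu mf).2.
  have [r r0 gr] : exists2 r : R, 0 <= r & (\int[mu]_x `|(g x)%:E| = r%:E)%E.
    exists (fine (\int[mu]_x `|(g x)%:E|)%E).
      by rewrite fine_ge0// integral_ge0.
    by rewrite fineK// ge0_fin_numE ?integral_ge0//; case/integrableP: g_int.
  (* The inner integral is at most [w s] times the L_1 norm [r] of [g]. *)
  apply: (@le_lt_trans _ _ (\int[mu]_s ((w s)%:E * r%:E))%E).
    apply: ge0_le_integral => //.
    - by move=> s _; exact: integral_ge0.
    - apply: (measurable_fun_fubini_tonelli_F (m2 := mu) (abse \o f)).
        exact: measurableT_comp.
      by move=> z; rewrite /= lee_fin.
    - rewrite (_ : (fun _ => _) = EFin \o (fun s => w s * r))//.
      by apply/measurable_EFinP;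
        exact: (measurable_funM w_meas (measurable_cst _)).
    - move=> s _; rewrite -gr -ge0_integralZl//; last 2 first.
      + by apply: measurableT_comp => //; exact/measurable_EFinP.
      + by rewrite lee_fin.
      apply: ge0_le_integral => //.
      + have mAg := measurable_funM (indic_sectionl s) mg.
        apply: measurableT_comp => //; apply/measurable_EFinP.
        exact: (measurable_funM (measurable_cst (w s)) mAg).
      + rewrite (_ : (fun _ => _) = EFin \o (fun x => w s * `|g x|))//.
        apply/measurable_EFinP; apply: measurable_funM;
          first exact: measurable_cst.
        exact: measurableT_comp.
      + move=> x _; rewrite /f /= -EFinM lee_fin normrM ger0_norm// ler_wpM2l//.
        rewrite normrM ler_piMl//.
        by case/andP: (indic01 (s, x)) => ? ?; rewrite ger0_norm.
  rewrite integralZr// muleC lte_mul_pinfty ?lee_fin//.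
  case/integrableP: w_int => _; congr (_ < _)%E; apply: eq_integral => s _.
  by rewrite gee0_abs ?lee_fin.
rewrite /Rintegral; congr fine.
transitivity (\int[mu]_x \int[mu]_s f (s, x))%E.
  apply: eq_integral => x _; rewrite EFinM psi_EFin -integralZr//.
  by apply: eq_integral => s _; rewrite /f /= -EFinM mulrA.
rewrite -(Fubini f_int); apply: eq_integral => s _.
rewrite EFinM /Rintegral fineK; last exact: integrable_fin_num.
by rewrite -integralZl//; apply: eq_integral => x _; rewrite -EFinM.
Qed.

End existence.

End weak_star_integral.

(** * The Gaussian weight *)

Section gauss.
Variables (R : realType) (t : R).
Hypothesis t_gt0 : 0 < t.

(** The weight is the centred normal density of variance [2 t], which gives its integrability. *)
Lemma gauss_weightE s : gauss_weight t s = normal_pdf 0 (Num.sqrt (2 * t)) s.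
Proof.
have s0 : Num.sqrt (2 * t) != 0 by rewrite gt_eqF// sqrtr_gt0 mulr_gt0.
rewrite /normal_pdf (negbTE s0) /normal_peak /normal_fun sqr_sqrtr;
  last by rewrite mulr_ge0// ltW.
rewrite /gauss_weight subr0; congr (_ ^-1 * expR _).
  by congr Num.sqrt; rewrite -mulr_natl; ring.
by rewrite -mulr_natl; field; rewrite gt_eqF.
Qed.

Lemma gauss_weight_ge0 s : 0 <= gauss_weight t s.
Proof. by rewrite /gauss_weight mulr_ge0 ?invr_ge0 ?sqrtr_ge0 ?expR_ge0. Qed.

Lemma gauss_weight_gt0 s : 0 < gauss_weight t s.
Proof.
rewrite /gauss_weight mulr_gt0 ?invr_gt0 ?sqrtr_gt0 ?expR_gt0//.
by rewrite !mulr_gt0 ?pi_gt0.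
Qed.

Lemma gauss_weight_nincr (s s' : R) :
  `|s| <= `|s'| -> gauss_weight t s' <= gauss_weight t s.
Proof.
move=> ss;
  rewrite /gauss_weight ler_wpM2l ?invr_ge0 ?sqrtr_ge0// ler_expR lerN2.
rewrite ler_pM2r ?invr_gt0 ?mulr_gt0//.
by rewrite -(real_normK (num_real s)) -(real_normK (num_real s')) ler_sqr.
Qed.

Lemma gauss_weight_integrable :
  lebesgue_measure.-integrable setT (EFin \o gauss_weight t).
Proof.
rewrite (_ : _ \o _ = fun s => (normal_pdf 0 (Num.sqrt (2 * t)) s)%:E).
  exact: integrable_normal_pdf.
by apply/funext => s; rewrite /= gauss_weightE.
Qed.

End gauss.

(** * Absence of extensions *)

Section no_extension.
Variable R : realType.
Notation mu := (@lebesgue_measure R).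

(** The right half of the interval on which [a] is the constant [h n]: it is crossed in time 1/8 for
    every [n], whereas its length varies with [n]. *)
Definition core n : set R := `[y n, y n + h n / 8]%classic.

Lemma core_measurable n : measurable (core n).
Proof. exact: measurable_itv. Qed.

Lemma measure_core n : mu (core n) = (h n / 8)%:E.
Proof.
have hn := h_gt0 R n.
rewrite /core lebesgue_measure_itv /= lte_fin ifT; last lra.
by rewrite -EFinB addrAC subrr add0r.
Qed.

Lemma core_finite n : (mu (core n) < +oo)%E.
Proof. by rewrite measure_core ltry. Qed.

(* [core n.+1] is [n.+1] times shorter than [core n], so sending the indicator
   of the former above [c] times the indicator of the latter costs a factor
   [c * n.+1 `^ p^-1] in the L_p norm. *)
Lemma no_continuous_extension (V : operator R) (p c : R) : 1 <= p -> 0 < c ->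
  (forall n, \forall x \ae mu, core n x -> c <= V (\1_(core n.+1)) x) ->
  ~ extends_to_continuous_operator p%:E V.
Proof.
move=> p1 c0 Vc [U [[ULp _ [M UM]] UV]].
have p0 : 0 < p by exact: lt_le_trans p1.
have pn0 : p != 0 by rewrite gt_eqF.
(* Taking p-th powers turns the length ratio into the factor [n.+1] itself; [|M|] replaces [M],
   whose sign is unknown. *)
suff bnd n : c `^ p * n.+1%:R <= `|M| `^ p.
  have cp0 : 0 < c `^ p by exact: powR_gt0.
  have := archi_boundP (divr_ge0 (powR_ge0 `|M| p) (ltW cp0));
    set n := Num.bound _.
  rewrite ltr_pdivrMr// => Mn; have := bnd n.
  by rewrite -natr1 mulrDr mulr1 mulrC => ?; lra.
pose f : R -> R := \1_(core n.+1).
have fp : f \in Lfun mu p%:E.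
  by apply: Lfun_indic => //; [exact: core_measurable|exact: core_finite].
have foo : f \in Lfun mu +oo%E by apply: Lfun_oo_indic; exact: core_measurable.
have mUf : measurable_fun setT (U f) by exact: Lfun_measurable (ULp _ fp).
have lower : ((c `^ p * (h n / 8))%:E <= 'N[mu]_p%:E[EFin \o U f] `^ p)%E.
  rewrite poweR_Lnorm//.
  have mUp : measurable_fun setT (fun x => (`|(EFin \o U f) x| `^ p)%E).
    apply: (measurableT_comp (measurable_poweR p));
      apply: measurableT_comp => //.
    exact/measurable_EFinP.
  apply: (@le_trans _ _ (\int[mu]_(x in core n) (`|(EFin \o U f) x| `^ p))%E);
      last first.
    apply: ge0_subset_integral => //; first exact: core_measurable.
    by move=> x _; exact: poweR_ge0.
  rewrite EFinM -measure_core -integral_cst; last exact: core_measurable.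
  apply: ae_ge0_le_integral => //.
  - exact: core_measurable.
  - by move=> x _; rewrite lee_fin powR_ge0.
  - by move=> x _; exact: poweR_ge0.
  - exact: measurable_funTS.
  - apply: (ae_impl2 _ (Vc n) (UV f fp foo)) => x Vx Ux cx.
    rewrite /= lee_fin Ux ge0_ler_powR ?nnegrE ?(ltW c0) ?(ltW p0)//.
    by rewrite (le_trans (Vx cx))// ler_norm.
have upper : ('N[mu]_p%:E[EFin \o U f] `^ p <= (`|M| `^ p * (h n.+1 / 8))%:E)%E.
  have h8 : 0 <= h n.+1 / 8 :> R by have := h_gt0 R n.+1; lra.
  have := UM f fp; rewrite Lnorm_indic ?measure_core//;
    last exact: core_measurable.
  rewrite poweR_EFin -EFinM => UfM.
  have : ('N[mu]_p%:E[EFin \o U f] <= (`|M| * (h n.+1 / 8) `^ p^-1)%:E)%E.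
    by apply: (le_trans UfM); rewrite lee_fin ler_wpM2r ?powR_ge0 ?ler_norm.
  move=> /(gt0_ler_poweR (ltW p0)).
  rewrite !in_itv/= Lnorm_ge0 leey lee_fin mulr_ge0 ?powR_ge0// leey.
  move=> /(_ erefl erefl); rewrite (powRM p (normr_ge0 M)) ?powR_ge0//.
  by rewrite -powRrM mulVf// powRr1.
have := le_trans lower upper; rewrite lee_fin (hS R n).
have hn := h_gt0 R n.+1.
rewrite (_ : _ * (n.+1%:R * h n.+1 / 8) = c `^ p * n.+1%:R * (h n.+1 / 8));
  last by ring.
by rewrite ler_pM2r//; lra.
Qed.

End no_extension.

(** * The group and the semigroup on indicators of cores *)

Section transport.
Variables (R : realType) (chi : nat -> R -> R).
Hypothesis chi_smooth : forall n, smooth (chi n).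
Hypothesis chi_ge0 : forall n x, 0 <= chi n x.
Hypothesis chi_int : forall n, \int[lebesgue_measure]_x chi n x = 1.
Hypothesis chi_supp : forall n, supp (chi n) `<=` `[- (h n / 8), h n / 8].
Hypothesis chi_even : forall n x, chi n (- x) = chi n x.
Notation mu := (@lebesgue_measure R).
Local Notation a := (coeff chi).
Local Notation F := (primitive (fun x => (a x)^-1)).

Let inv_cont : continuous (fun x => (a x)^-1).
Proof. exact/smooth_continuous/coeff_inv_smooth. Qed.

Let inv_ge1 x : 1 <= (a x)^-1.
Proof. exact: coeff_inv_ge1. Qed.

Let F_cont : continuous F.
Proof. exact: continuous_primitive. Qed.

(** In the coordinate [F] all cores become translates of [[0, 1/8]] by integers, and the flow
    becomes translation. *)
Lemma core_primitive n x : core n x <-> n%:R <= F x <= n%:R + 1 / 8.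
Proof.
have hn := h_gt0 R n.
have Fl : F (y n) = n%:R by exact: primitive_inv_y.
have Fr : F (y n + h n / 8) = n%:R + 1 / 8.
  rewrite (@primitive_inv_core _ _ chi_smooth chi_int chi_supp chi_even n).
    by rewrite addrAC subrr add0r; field; rewrite gt_eqF.
  by apply/andP; split; lra.
rewrite /core /= in_itv/= -[in X in _ <-> X]Fr -Fl.
by rewrite !(primitive_inv_le inv_cont inv_ge1).
Qed.

Lemma transport_core s n x : transport_group a s (\1_(core n)) x =
  (n%:R <= F x - s <= n%:R + 1 / 8)%R%:R.
Proof.
rewrite /transport_group indicE -(primitive_flow inv_cont inv_ge1 (- s)).
by congr (nat_of_bool _)%:R; apply/idP/idP; rewrite inE => /core_primitive.
Qed.

Lemma transport_group_no_extension (p : R) : 1 <= p ->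
  ~ extends_to_continuous_group p%:E (transport_group a).
Proof.
move=> p1 [U [extU _]].
apply: (@no_continuous_extension _ (transport_group a (- 1)) p 1) => //;
  last by exists (U (- 1)).
move=> n; apply: ae_all => x /core_primitive/andP[nx xn].
rewrite transport_core opprK (_ : _ && _ = true)//.
by rewrite -natr1; apply/andP; split; lra.
Qed.

Local Notation RR := (measurableTypeR R * measurableTypeR R)%type.

(** The pairs of a time [s] and a point [x] with [e^{-sX} x] in [core n], expressed through [F]. As
    a subset of the plane it makes the translated indicators jointly measurable. *)
Definition reach n : set RR :=
  [set z | n%:R <= F z.2 - z.1 <= n%:R + 1 / 8].

(** An explicit representative of [S_t] applied to the indicator of [core n]. *)
Definition heat_core t n (x : R) : R :=
  \int[mu]_s (gauss_weight t s * \1_(reach n) (s, x)).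

Lemma heat_coreP t n : 0 < t ->
  is_weak_star_integral (gauss_weight t)
    (fun s => transport_group a s (\1_(core n))) (heat_core t n).
Proof.
move=> t0; have mF : measurable_fun setT F by apply: continuous_measurable_fun.
have mA : measurable (reach n).
  have mFs : measurable_fun setT (fun z : RR => F z.2 - z.1).
    apply: measurable_funB; last exact: measurable_fst.
    exact: (measurableT_comp mF measurable_snd).
  have := mFs measurableT `[n%:R, n%:R + 1 / 8]%classic (measurable_itv _).
  by rewrite setTI; congr measurable; apply/funext => z;
    rewrite /reach /= in_itv.
have := weak_star_integral_exists (gauss_weight_ge0 t)
  (gauss_weight_integrable t0) mA.
rewrite (_ : (fun s x => \1_(reach n) (s, x)) =
             (fun s => transport_group a s \1_(core n)))//.
apply/funext => s; apply/funext => x; rewrite transport_core indicE.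
by congr (nat_of_bool _)%:R; apply/idP/idP; rewrite inE.
Qed.

(** The times [s] at which [e^{-sX} x] lies in [core n.+1] form an interval [J] of length 1/8 inside
    [[-9/8, -7/8]]. There [|s| <= 2], so the weight is at least its value at 2. *)
Lemma heat_core_ge t n x : 0 < t -> core n x ->
  gauss_weight t 2 / 8 <= heat_core t n.+1 x.
Proof.
move=> t0 /core_primitive/andP[nx xn]; rewrite /heat_core.
pose J : set R := `[F x - (n.+1%:R + 1 / 8), F x - n.+1%:R]%classic.
have JA s : \1_(reach n.+1) (s, x) = \1_J s :> R.
  rewrite !indicE; congr (nat_of_bool _)%:R.
  apply/idP/idP;
    rewrite !inE /J /reach /= in_itv/= => /andP[? ?]; apply/andP; split; lra.
have -> : \int[mu]_s (gauss_weight t s * \1_(reach n.+1) (s, x)) =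
    \int[mu]_(s in J) gauss_weight t s.
  rewrite [RHS]Rintegral_mkcond; apply: eq_Rintegral => s _.
  by rewrite JA patchE indicE; case: (s \in J); rewrite ?mulr1 ?mulr0.
have mJ : measurable J by exact: measurable_itv.
have muJ : mu J = (1 / 8)%:E.
  rewrite /J lebesgue_measure_itv /= lte_fin ifT; last lra.
  by rewrite -EFinB; congr EFin; ring.
have -> : gauss_weight t 2 / 8 = \int[mu]_(s in J) gauss_weight t 2.
  transitivity (gauss_weight t 2 * fine (mu J)); first by rewrite muJ /= div1r.
  by rewrite Rintegral_cst.
apply: le_Rintegral => //.
- by apply: continuous_itv_integrable => s; exact: cvg_cst.
- exact: integrableS (gauss_weight_integrable t0).
- move=> s; rewrite /J /= in_itv/= -natr1 => /andP[s1 s2].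
  apply: gauss_weight_nincr => //.
  by rewrite (ger0_norm (ler0n R 2)) ler_norml; apply/andP; split; lra.
Qed.

(** Since [heat_core] is a weak* integral, the one chosen by [heat_semigroup] is genuine, and it
    agrees with [heat_core] almost everywhere on [core n]. *)
Lemma heat_semigroup_no_extension (p t : R) : 1 <= p -> 0 < t ->
  ~ extends_to_continuous_operator p%:E (heat_semigroup a t).
Proof.
move=> p1 t0;
  apply: (@no_continuous_extension _ _ p (gauss_weight t 2 / 8)) => //.
  by rewrite divr_gt0// gauss_weight_gt0.
move=> n; have W := heat_coreP n.+1 t0.
have W' : is_weak_star_integral (gauss_weight t)
    (fun s => transport_group a s \1_(core n.+1))
    (heat_semigroup a t \1_(core n.+1)).
  exact: (getPex (ex_intro _ _ W)).
have := weak_star_integral_unique W W' (core_measurable n) (core_finite R n).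
apply: ae_impl => x E cx; rewrite -E//; exact: heat_core_ge.
Qed.

End transport.

Theorem mainTheorem5 (R : realType) (chi : nat -> R -> R)
    (chi_smooth : forall n, smooth (chi n))
    (chi_compact : forall n, compact (supp (chi n)))
    (chi_ge0 : forall n x, 0 <= chi n x)
    (chi_int : forall n, \int[lebesgue_measure]_x chi n x = 1)
    (chi_supp : forall n, supp (chi n) `<=` `[- (h n / 8), h n / 8])
    (chi_even : forall n x, chi n (- x) = chi n x) :
  let a := coeff chi in
  [/\ smooth a,
      forall x, 0 < a x,
      exists M : R, forall x, a x <= M
    & inf (range a) = 0] /\
  [/\ (forall n : nat, (0 < n)%N ->
        [/\ forall x, x \in `[y n - h n / 8, y n + h n / 8] -> a x = h n,
            \int[lebesgue_measure]_(x in `[y n, y n.+1]) (a x)^-1 = 1,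
            dist a (y n) (y n.+1) = 1
          & a (y n) = n.+1%:R * a (y n.+1)]) /\
      ~ (exists C w : R, [/\ 1 <= C, 0 <= w
          & forall x z, a z <= C * expR (w * dist a x z) * a x]),
      (forall p : R, 1 <= p ->
        ~ extends_to_continuous_group p%:E (transport_group a))
    & (forall p t : R, 1 <= p -> 0 < t ->
        ~ extends_to_continuous_operator p%:E (heat_semigroup a t))].
Proof.
move=> a; split; split.
- exact: coeff_smooth.
- exact: coeff_gt0.
- by exists 1; exact: coeff_le1.
- exact: inf_coeff.
- split; last exact: coeff_not_exp_bounded.
  move=> n _; split.
  + by move=> x; exact: coeff_core.
  + exact: integral_inv_y.
  + exact: dist_y.
  + by rewrite /a !coeff_y// hS.
- by move=> p; exact: transport_group_no_extension.
- by move=> p t; exact: heat_semigroup_no_extension.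
Qed.
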